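(* Let $P$ be a finite geometric lattice, fix a total order on its atoms, and let $S=\{s_1<\dots<s_k\}$ be a set of nontrivial ranks of $P$, with $m=\max S=s_k$ and $S'=S\setminus\{m\}$. For each $u\in P$ of rank $m$, consider the geometric lattice $[\hat0,u]$ (whose atoms are the atoms of $P$ below $u$, with the induced order) and the set of elements $\bar f_{chain}(v_F)$, where $F$ ranges over the standard fillings of $\mathrm{Rib}(s_1,s_2-s_1,\dots,s_k-s_{k-1})$ whose reading word is an $\mathrm{NBC}^+$ basis of $[\hat0,u]$, and $\bar f_{chain}$ is taken with respect to the rank set $S'$ in $[\hat0,u]$. Then the union over all $u$ of rank $m$ of these sets is a basis of the rank-selected Whitney homology $W\!H_S(P)$.
   Context: $W\!H_S(P):=\bigoplus_{u:\ \mathrm{rk}(u)=\max S}\tilde H_{|S|-2}\big(\Delta((\hat0,u)^{S'});\mathbb C\big)$, where $(\hat0,u)^{S'}$ is the set of $y$ with $\hat0<y<u$ and rank in $S'$ (if $S'=\emptyset$ the order complex is empty, with reduced homology $\mathbb C$ in degree $-1$). A geometric lattice is a finite atomic semimodular lattice; $A(x)$ is the set of atoms below $x$. An NBC independent set is a set $\{a_1,\dots,a_l\}$ of atoms whose join has rank $l$ and such that every atom not in the set lying below its join comes later in the atom order than at least one element of the set. An $\mathrm{NBC}^+$ basis of a geometric lattice $L$ of rank $r$ is an ordered NBC independent set $(a_1,\dots,a_r)$ with $a_j=\min(A(a_1\vee\dots\vee a_j)\setminus A(a_1\vee\dots\vee a_{j-1}))$ for each $j$. $\mathrm{Rib}(r_1,\dots,r_p)$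 is the ribbon (connected skew shape with no $2\times2$ square) with rows of lengths $r_1,\dots,r_p$ from bottom to top, each row starting directly above the last box of the row below. Reading word: entries read left to right, bottom row to top. Standard: entries increase in atom order left to right in rows and top to bottom in columns. Tabloid $\{F\}$: $F$ modulo permuting entries within rows; $v_F=\sum_{\sigma\in\mathrm{Col}_F}\mathrm{sgn}(\sigma)\{\sigma F\}$ with $\mathrm{Col}_F$ the permutations of entries preserving columns. For a filling of $\mathrm{Rib}(s_1,\dots,s_k-s_{k-1})$ with reading word $(F_1,\dots,F_m)$ forming a basis of $[\hat0,u]$, $\bar f_{chain}(\{F\})$ is the chain $F_1\vee\dots\vee F_{s_1}<\dots<F_1\vee\dots\vee F_{s_{k-1}}$ in $(\hat0,u)^{S'}$, an oriented simplex; extended linearly. *)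

(* Defs.v *)
From HB Require Import structures.
From mathcomp Require Import all_boot all_order all_algebra all_fingroup.
From mathcomp Require Import reals complex.
Unset Strict Implicit. Unset Printing Implicit Defensive.
Import Order.TTheory GRing.Theory Num.Theory.

Section Geometric.
Context {disp : Order.disp_t} {T : finTBLatticeType disp}.
Local Open Scope order_scope.

Definition atom (x : T) : bool :=
  (\bot < x) && [forall y : T, ~~ ((\bot < y) && (y < x))].

Definition covers (x y : T) : bool :=
  (x < y) && [forall z : T, ~~ ((x < z) && (z < y))].

Definition atomic : Prop :=
  forall x : T, x = \join_(a : T | atom a && (a <= x)) a.

Definition semimodular : Prop :=
  forall x y : T, covers (x `&` y) x -> covers y (x `|` y).

Definition geometric : Prop := atomic /\ semimodular.

Definition rank (x : T) : nat :=
  (\max_(n < #|T| | [exists t : n.-tuple T,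
        path (fun a b : T => (a < b)%O) \bot t && (last \bot t == x)]) n)%N.

Definition joinw (w : seq T) : T := \join_(a <- w) a.

(** the fixed total order on atoms, given by a duplicate-free list [ao]
    of all atoms: a comes before b iff index a ao < index b ao *)
Definition ltA (ao : seq T) (a b : T) : bool := (index a ao < index b ao)%N.
Definition leA (ao : seq T) (a b : T) : bool := (index a ao <= index b ao)%N.

Definition nbc_indep (ao : seq T) (w : seq T) : bool :=
  [&& uniq w, all atom w, rank (joinw w) == size w &
   [forall b : T, (atom b && (b <= joinw w) && (b \notin w))
                    ==> has (fun a => ltA ao a b) w]].

(** NBC+ basis of the geometric lattice [\bot, u] (its atoms are the atoms
    of P below u, with the induced order; its rank is rank u) *)
Definition nbc_plus_basis (ao : seq T) (u : T) (w : seq T) : bool :=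
  [&& all (fun a => a <= u) w, nbc_indep ao w, size w == rank u &
   [forall j : 'I_(size w),
      let J  := joinw (take j.+1 w) in
      let J' := joinw (take j w) in
      let a  := nth \bot w j in
      [&& atom a, a <= J, ~~ (a <= J') &
       [forall b : T, (atom b && (b <= J) && ~~ (b <= J')) ==> leA ao a b]]]].

(** Ribbon Rib(s_1, s_2 - s_1, ..., s_k - s_{k-1}); reading-word positions
    q = 0 .. s_k - 1 (0-indexed).  Row (0-indexed, from the bottom) of q is
    #{i | s_i <= q}; since each row starts directly above the last box of the
    previous row, the column of q is q - row q. *)
Definition rowof (s : seq nat) (q : nat) : nat := count (fun x => x <= q)%N s.
Definition colof (s : seq nat) (q : nat) : nat := (q - rowof s q)%N.

Definition standard (s : seq nat) (ao : seq T) (w : seq T) : bool :=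
  [forall p : 'I_(size w), forall q : 'I_(size w),
     ((rowof s p == rowof s q) && (p < q)%N)
       ==> ltA ao (nth \bot w p) (nth \bot w q)] &&
  [forall p : 'I_(size w), forall q : 'I_(size w),
     ((colof s p == colof s q) && (rowof s p < rowof s q)%N)
       ==> ltA ao (nth \bot w q) (nth \bot w p)].

(** S-flags t_1 < ... < t_k with rank t_i = s_i.  For u = t_k, the prefix
    (t_1 < ... < t_{k-1}) is exactly a top-dimensional ((k-2)-dimensional)
    oriented simplex of Delta((\bot,u)^{S'}); the flag space therefore
    encodes  (+)_{u : rank u = s_k} C_{k-2}(Delta((\bot,u)^{S'})). *)
Definition valid_flag (s : seq nat) (t : {ffun 'I_(size s) -> T}) : bool :=
  [forall i : 'I_(size s), rank (t i) == nth 0%N s i] &&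
  [forall i : 'I_(size s), forall j : 'I_(size s), (i < j)%N ==> (t i < t j)].

Definition upd (s : seq nat) (t : {ffun 'I_(size s) -> T}) (j : 'I_(size s))
  (y : T) : {ffun 'I_(size s) -> T} := [ffun i => if i == j then y else t i].

Definition chainflag (s : seq nat) (w : seq T) : {ffun 'I_(size s) -> T} :=
  [ffun i : 'I_(size s) => joinw (take (nth 0%N s i) w)].

End Geometric.

Section Chains.
Context (R : realType) {disp : Order.disp_t} {T : finTBLatticeType disp}.
Local Open Scope ring_scope.

Definition flagspace (s : seq nat) := {ffun {ffun 'I_(size s) -> T} -> R[i]^o}.

Definition flagvec (s : seq nat) (t : {ffun 'I_(size s) -> T}) : flagspace s :=
  [ffun t' => (t' == t)%:R].

(** f is a cycle: supported on S-flags and killed by the (augmented)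
    boundary map.  The face of (t_1<..<t_{k-1}) omitting position j
    (j < k-1) receives the coefficient (-1)^j * sum_y f(t[j:=y]); as the
    complex has no simplices of dimension > k-2, the reduced homology in
    degree k-2 = |S|-2 is exactly this cycle space. *)
Definition is_cycle (s : seq nat) (f : flagspace s) : bool :=
  [forall t : {ffun 'I_(size s) -> T}, ~~ valid_flag s t ==> (f t == 0)] &&
  [forall t : {ffun 'I_(size s) -> T}, forall j : 'I_(size s),
     (valid_flag s t && (j.+1 < size s)%N) ==>
     ((\sum_(y : T | valid_flag s (upd s t j y)) f (upd s t j y)) == 0)].

(** fbar_chain(v_F), v_F = sum_{sigma in Col_F} sgn(sigma) {sigma F};
    sigma permutes reading-word positions preserving columns. *)
Definition vF (s : seq nat) (w : (last 0%N s).-tuple T) : flagspace s :=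
  \sum_(sigma : 'S_(last 0%N s) |
          [forall i : 'I_(last 0%N s), colof s (sigma i) == colof s i])
     ((-1) ^+ sigma) *:
       flagvec s (chainflag s [tuple tnth w (sigma i) | i < last 0%N s]).

Definition WH_family (s : seq nat) (ao : seq T) : seq (flagspace s) :=
  [seq vF s p.2 | p <- enum [pred p : T * (last 0%N s).-tuple T |
       [&& rank p.1 == last 0%N s, standard s ao p.2 &
           nbc_plus_basis ao p.1 p.2]]].

End Chains.

(* Main.v *)
(** Label a pair [x < y] by [min (A(y) \ A(x))].  The NBC+ bases are the label
    words of maximal chains, and every [S]-flag is refined by a unique maximal
    chain whose word ascends inside each block of ranks; this word is
    lexicographically least among the independent words passing through the
    flag.  Standard NBC+ fillings [F] are the words of this kind that descend
    at every rank of [S'].  Each nontrivial column permutation of [F] produces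
    a lexicographically smaller word, so the flag of [F] is the leading term of
    [v_F], with coefficient 1.  Conversely, if the word of a flag does not
    descend at some break, a boundary relation expresses the coefficient of
    that flag in a cycle through coefficients of flags with larger words; hence
    a cycle that vanishes on the flags of all standard NBC+ fillings is 0.
    Triangularity then gives both independence and spanning. *)
Require Import Defs.
From HB Require Import structures.
From mathcomp Require Import all_boot all_order all_algebra all_fingroup.
From mathcomp Require Import reals complex.
Import Order.TTheory GRing.Theory Num.Theory.

Set Implicit Arguments.
Unset Strict Implicit.
Unset Printing Implicit Defensive.

(** * Rank, joins of words of atoms, and independence in a geometric lattice *)

Section Rank.
Context {disp : Order.disp_t} {T : finTBLatticeType disp}.
Implicit Types (x y z a b c : T) (t w v : seq T).
Local Open Scope order_scope.

Lemma rank_ge t : path <%O \bot t -> (size t <= rank (last \bot t))%N.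
Proof.
(* A strict chain has no repetition, so its length falls within the bound [n < #|T|] built into
   [rank]. *)
move=> pt; have lt_t : (size t < #|T|)%N.
  have /card_uniqP cE := sorted_uniq (@lt_trans _ T) (@ltxx _ T) (pt : sorted <%O (\bot :: t)).
  by have := max_card (mem (\bot :: t)); rewrite cE.
rewrite /rank; apply: (leq_bigmax_cond (Ordinal lt_t)) => /=.
by apply/existsP; exists (in_tuple t); rewrite /= pt eqxx.
Qed.

Lemma rank_chain x :
  exists t, [/\ path <%O \bot t, last \bot t = x & size t = rank x].
Proof.
pose P (n : 'I_#|T|) := [exists t : n.-tuple T,
  path (fun a b : T => (a < b)%O) \bot t && (last \bot t == x)].
have [n Pn] : exists n, P n.
  have [x0|nx] := eqVneq x \bot.
    have lt0 : (0 < #|T|)%N by apply/card_gt0P; exists \bot.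
    by exists (Ordinal lt0); apply/existsP; exists [tuple]; rewrite /= x0.
  have lt1 : (1 < #|T|)%N by apply/card_gt1P; exists x, \bot.
  exists (Ordinal lt1); apply/existsP; exists [tuple x].
  by rewrite /= eqxx lt0x nx.
have n0 : (0 < #|P|)%N by apply/card_gt0P; exists n.
have [m /existsP[t /andP[pt /eqP lt]] rE] := eq_bigmax_cond (fun n : 'I__ => n : nat) n0.
by exists t; split=> //; rewrite size_tuple /rank -rE.
Qed.

Lemma rank_lt x y : x < y -> (rank x < rank y)%N.
Proof.
move=> xy; have [t [pt lt <-]] := rank_chain x.
have := @rank_ge (rcons t y); rewrite rcons_path pt lt xy last_rcons size_rcons.
exact.
Qed.

Lemma rank_eq x y : x <= y -> (rank y <= rank x)%N -> x = y.
Proof. by rewrite le_eqVlt => /predU1P[->//|/rank_lt]; rewrite ltnNge => /negP. Qed.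

Lemma joinw_cons a w : joinw (a :: w) = a `|` joinw w.
Proof. exact: big_cons. Qed.

Lemma joinw_cat v w : joinw (v ++ w) = joinw v `|` joinw w.
Proof. exact: big_cat. Qed.

Lemma joinw_rcons w a : joinw (rcons w a) = joinw w `|` a.
Proof. by rewrite -cats1 joinw_cat /joinw big_seq1. Qed.

Lemma perm_joinw v w : perm_eq v w -> joinw v = joinw w.
Proof. exact: perm_big. Qed.

Lemma joinw_le w x : (joinw w <= x) = all (<= x) w.
Proof.
by elim: w => [|a w IH]; rewrite ?joinw_cons /= ?leUx ?IH // /joinw big_nil le0x.
Qed.

Lemma joinw_take_le w p q : (p <= q)%N -> joinw (take p w) <= joinw (take q w).
Proof.
by move=> pq; rewrite -(subnK pq) addnC takeD joinw_cat leUl.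
Qed.

Lemma joinw_takeS w q : (q < size w)%N ->
  joinw (take q.+1 w) = joinw (take q w) `|` nth \bot w q.
Proof. by move=> qw; rewrite (take_nth \bot) // joinw_rcons. Qed.

Lemma le_joinw_nth w q e :
  (q < e)%N -> (q < size w)%N -> nth \bot w q <= joinw (take e w).
Proof.
by move=> qe qw; apply: le_trans _ (joinw_take_le w qe); rewrite joinw_takeS ?leUr.
Qed.

(** Finds the letter [a] that can be exchanged for [b]: the one at which [b] first becomes
    dependent. *)
Lemma joinw_first w z b : ~~ (b <= z) -> b <= z `|` joinw w ->
  exists w1 a w2, [/\ w = w1 ++ a :: w2, ~~ (b <= z `|` joinw w1)
                   & b <= z `|` joinw w1 `|` a].
Proof.
elim: w z => [|a w IH] z bz; first by rewrite /joinw big_nil joinx0 (negPf bz).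
rewrite joinw_cons joinA => bw; have [ba|nba] := boolP (b <= z `|` a).
  by exists [::], a, w; rewrite /joinw big_nil joinx0.
have [w1 [c [w2 [-> b1 b2]]]] := IH _ nba bw.
by exists (a :: w1), c, w2; rewrite joinw_cons joinA.
Qed.

Lemma joinw_step w b p q : (p <= q)%N -> ~~ (b <= joinw (take p w)) ->
  b <= joinw (take q w) ->
  exists2 i, (p <= i < q)%N & ~~ (b <= joinw (take i w)) && (b <= joinw (take i.+1 w)).
Proof.
move=> + bp; elim: q => [|q IH]; first by rewrite leqn0 => /eqP <-; rewrite (negPf bp).
rewrite leq_eqVlt ltnS => /predU1P[<-|pq bq]; first by rewrite (negPf bp).
have [bq'|nbq] := boolP (b <= joinw (take q w)); last first.
  by exists q; rewrite ?pq ?nbq ?ltnSn.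
by have [i /andP[pi iq] ?] := IH pq bq'; exists i; rewrite ?pi ?ltnS 1?ltnW.
Qed.

Context (geomT : geometric (T := T)).

Lemma atom_between x y : x < y -> exists2 a, atom a & (a <= y) && ~~ (a <= x).
Proof.
move=> xy; have [/existsP[a /and3P[*]]|/existsPn nex] :=
  boolP [exists a, [&& atom a, a <= y & ~~ (a <= x)]]; first by exists a => //; apply/andP.
have : y <= x.
  rewrite (geomT.1 y); apply/joinsP => a /andP[at_a ay].
  by have := nex a; rewrite at_a ay /= negbK.
by rewrite (lt_geF xy).
Qed.

(** The atom [a] meets [x] in [\bot], which [a] covers; semimodularity carries this cover up to
    [x]. *)
Lemma covers_atom x a : atom a -> ~~ (a <= x) -> covers x (x `|` a).
Proof.
move=> /andP[a0 /forallP amin] nax; rewrite joinC; apply: geomT.2.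
have -> : a `&` x = \bot.
  apply/eqP; have := amin (a `&` x); rewrite lt0x negb_and negbK => /orP[//|].
  by rewrite lt_neqAle leIl andbT negbK => /eqP/meet_idPl; rewrite (negPf nax).
by rewrite /covers a0; apply/forallP.
Qed.

(** The join of [x] and [b] lies strictly above [x] and below the join of [x] and [a], which covers
    [x]; nothing lies strictly between. *)
Lemma atom_exchange x a b :
  atom a -> atom b -> ~~ (b <= x) -> b <= x `|` a -> x `|` b = x `|` a.
Proof.
move=> ata atb nbx bxa; have nax : ~~ (a <= x).
  by apply: contra nbx => ax; move: bxa; rewrite (join_l ax).
have /andP[_ /forallP/(_ (x `|` b))] := covers_atom ata nax.
have -> /= : x < x `|` b by rewrite lt_neqAle leUl andbT eq_sym eq_joinl.
by rewrite lt_neqAle leUx leUl bxa !andbT negbK => /eqP.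
Qed.

(** Steinitz exchange. The first step of the chain yields an atom [b] below [c1] and not below [c].
    Trading a letter [a] of [w] for [b] keeps the total join, and [b] is absorbed into [x], so chain
    and word both shrink by one. *)
Lemma chain_le_size x w c t : all atom w -> x <= c -> path <%O c t ->
  last c t <= x `|` joinw w -> (size t <= size w)%N.
Proof.
have [n] := ubnP (size w); elim: n => // n IH in x w c t *.
rewrite ltnS => wn atw xc; case: t => [//|c1 t] /= /andP[cc1 pt] lt.
have [b atb /andP[bc1 nbc]] := atom_between cc1.
have nbx : ~~ (b <= x) by apply: contra nbc => /le_trans; apply.
have c1l : c1 <= last c1 t.
  case: t pt {lt} => //= c2 t pt; apply/ltW.
  have /allP := @order_path_min _ _ c1 (c2 :: t) lt_trans pt; apply; exact: mem_last.
have [w1 [a [w2 [wE nb1 b1]]]] := joinw_first nbx (le_trans bc1 (le_trans c1l lt)).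
move: atw; rewrite wE all_cat /= => /and3P[at1 ata at2].
rewrite size_cat /= addnS ltnS -size_cat.
apply: (IH (x `|` b) _ c1) => //.
- by move: wn; rewrite wE !size_cat /= addnS.
- by rewrite all_cat at1.
- by rewrite leUx bc1 (le_trans xc (ltW cc1)).
apply: (le_trans lt); rewrite wE !joinw_cat joinw_cons !joinA.
by rewrite -(atom_exchange ata atb nb1 b1) (joinAC x).
Qed.

Lemma rank_joinw_le w : all atom w -> (rank (joinw w) <= size w)%N.
Proof.
move=> atw; have [t [pt lt <-]] := rank_chain (joinw w).
by apply: (chain_le_size atw (lexx \bot) pt); rewrite lt leUr.
Qed.

(* Equivalent to [rank (joinw w) = size w] for words of atoms; see [rank_indep]
   and [indep_rank]. *)
Definition indep w := forall q, (q < size w)%N ->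
  atom (nth \bot w q) /\ ~~ (nth \bot w q <= joinw (take q w)).

Lemma indep_atom w : indep w -> all atom w.
Proof. by move=> iw; apply/(all_nthP \bot) => i /iw[]. Qed.

Lemma indep_rank_ge w n : indep w -> (n <= size w)%N ->
  (n <= rank (joinw (take n w)))%N.
Proof.
move=> iw; elim: n => // n IH nw; apply: leq_ltn_trans (IH (ltnW nw)) _.
apply: rank_lt; rewrite joinw_takeS // lt_neqAle leUl andbT eq_sym eq_joinl.
by have [] := iw n nw.
Qed.

Lemma indep_rank w n : indep w -> (n <= size w)%N -> rank (joinw (take n w)) = n.
Proof.
move=> iw nw; apply/eqP; rewrite eqn_leq indep_rank_ge // andbT.
apply: leq_trans (rank_joinw_le _) _; last by rewrite size_takel.
by apply/allP => a /mem_take; apply/allP/indep_atom.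
Qed.

(** A letter below the join of its predecessors could be dropped without changing the join, leaving
    fewer atoms than the rank. *)
Lemma rank_indep w : all atom w -> rank (joinw w) = size w -> indep w.
Proof.
move=> atw rw q qw; have atq := allP atw _ (mem_nth \bot qw); split=> //.
apply/negP => wq; pose v := take q w ++ drop q.+1 w.
have wE : w = take q w ++ nth \bot w q :: drop q.+1 w.
  by rewrite -drop_nth // cat_take_drop.
have sw : size w = (size v).+1 by rewrite {1}wE !size_cat /= addnS.
have vE : joinw v = joinw w.
  rewrite [in RHS]wE !joinw_cat joinw_cons joinA; congr (_ `|` _).
  by rewrite (join_l wq).
have atv : all atom v.
  by apply/allP => a; rewrite mem_cat => /orP[/mem_take|/mem_drop]; apply/allP.
by have := rank_joinw_le atv; rewrite vE rw sw ltnn.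
Qed.

Lemma indep_uniq w : indep w -> uniq w.
Proof.
move=> iw; apply/(uniqP \bot) => p q.
rewrite !inE; wlog: p q / (p < q)%N => [H|pq pw qw pE].
  by have [pq|qp|->//] := ltngtP p q => ? ? E; [|symmetry]; apply: H.
by have [_] := iw q qw; rewrite -pE le_joinw_nth.
Qed.

(** The join and the length ignore the order of the letters, and for words of atoms they decide
    independence. *)
Lemma perm_indep v w : perm_eq v w -> indep w -> indep v.
Proof.
move=> pvw iw; apply: rank_indep.
  by rewrite (perm_all _ pvw) indep_atom.
have := indep_rank iw (leqnn _).
by rewrite take_size (perm_joinw pvw) (perm_size pvw).
Qed.
End Rank.

(** * Label words, ascents within blocks, and lexicographic minimality *)

Section Words.
Context {disp : Order.disp_t} {T : finTBLatticeType disp} (ao : seq T).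
Context (geomT : geometric (T := T)) (ao_uniq : uniq ao).
Context (ao_atom : forall a : T, (a \in ao) = atom a).
Implicit Types (x y a b : T) (w v : seq T) (D : pred nat).
Local Open Scope order_scope.

Lemma index_eq a b : atom a -> index a ao = index b ao -> a = b.
Proof.
rewrite -ao_atom => aao E; rewrite -(nth_index \bot aao) E nth_index //.
by rewrite -index_mem -E index_mem.
Qed.

(* The label sequence of the maximal chain of prefix joins of [w], where the
   label of [x < y] is [min (A(y) \ A(x))]. *)
Definition labelseq w := indep w /\
  forall q b, (q < size w)%N -> atom b -> b <= joinw (take q.+1 w) ->
    ~~ (b <= joinw (take q w)) -> leA ao (nth \bot w q) b.

(** [D e] marks a block boundary between positions [e.-1] and [e]. The predicate is left general so
    that a single break of [s] can later be removed. *)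
Definition ascends D w := forall p q, (p <= q < size w)%N ->
  (forall e, (p < e <= q)%N -> ~~ D e) -> leA ao (nth \bot w p) (nth \bot w q).

(** The atom [b] enters the prefix joins at some step [i] of the block; the label at [i] is at most
    [b], and the ascent from [q] to [i] finishes. *)
Lemma labelseq_min D w q e b : labelseq w -> ascends D w -> (e <= size w)%N ->
  (forall i, (q < i < e)%N -> ~~ D i) -> atom b ->
  b <= joinw (take e w) -> ~~ (b <= joinw (take q w)) -> leA ao (nth \bot w q) b.
Proof.
move=> [iw minw] asc ew De atb be bq.
have qe : (q <= e)%N.
  by rewrite leqNgt; apply: contra bq => /ltnW eq; apply: le_trans be (joinw_take_le w eq).
have [i /andP[qi ie] /andP[bi bi1]] := joinw_step qe bq be.
have iw' := leq_trans ie ew.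
apply: leq_trans (minw i b iw' atb bi1 bi).
apply: asc => [|j /andP[qj ji]]; first by rewrite qi.
by apply: De; rewrite qj (leq_ltn_trans ji ie).
Qed.

(** Reads a word as a number in base [(size ao).+1], a base large enough for every value of [index].
    Words of equal length are thereby compared lexicographically, and the order can drive
    inductions. *)
Fixpoint code w := (if w is a :: v then
  index a ao * (size ao).+1 ^ size v + code v else 0)%N.

Lemma code_bound w : (code w < (size ao).+1 ^ size w)%N.
Proof.
elim: w => [|a w IH] //=; apply: leq_trans (_ : (index a ao).+1 * (size ao).+1 ^ size w <= _)%N.
  by rewrite mulSn addnC ltn_add2r.
by rewrite expnS leq_mul2r ltnS index_size orbT.
Qed.

Lemma code_lt w v q : size w = size v -> (q < size w)%N -> take q w = take q v ->
  (index (nth \bot w q) ao < index (nth \bot v q) ao)%N -> (code w < code v)%N.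
Proof.
elim: w v q => [|a w IH] [|b v] [|q] //= [sE] qw; first last.
  by case=> -> tE lt; rewrite sE ltn_add2l (IH v q).
  move=> _ ab; rewrite sE; apply: leq_trans (leq_addr _ _).
  apply: leq_trans (_ : (index a ao).+1 * (size ao).+1 ^ size v <= _)%N.
    by rewrite mulSn addnC ltn_add2r -sE code_bound.
  by rewrite leq_mul2r ab orbT.
Qed.

Lemma first_diff w v : size w = size v -> w = v \/
  exists q, [/\ (q < size w)%N, take q w = take q v & nth \bot w q != nth \bot v q].
Proof.
elim: w v => [|a w IH] [|b v] //=; first by left.
move=> [sE].
have [<-|ab] := eqVneq a b; last by right; exists 0%N.
have [->|[q [qw tE nE]]] := IH v sE; first by left.
by right; exists q.+1; rewrite /= tE.
Qed.

(** Let [q] be the first difference and [e] the next marked rank after it. The letter of [v] at [q]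
    lies below the common join at [e] but not below the common prefix, so it competes in the minimum
    attained by [w]. *)
Lemma labelseq_code_min D w v : labelseq w -> ascends D w -> indep v ->
  size w = size v -> D (size w) ->
  (forall e, (e <= size w)%N -> D e -> joinw (take e w) = joinw (take e v)) ->
  w = v \/ (code w < code v)%N.
Proof.
move=> lw asc iv sE Dm wv; have [|[q [qw tE nE]]] := first_diff sE; first by left.
right; apply: (code_lt sE qw tE).
have [atv nv] := iv q (leq_trans qw (eq_leq sE)).
have exD : exists e, (q < e)%N && D e by exists (size w); rewrite qw.
have [e /andP[qe De] mine] := ex_minnP exD.
have ew : (e <= size w)%N by apply: mine; rewrite qw.
have : leA ao (nth \bot w q) (nth \bot v q).
  apply: (labelseq_min lw asc ew _ atv).
  - move=> i /andP[qi ie]; apply: contraL ie => Di.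
    by rewrite -leqNgt mine ?qi.
  - by rewrite wv // le_joinw_nth // -sE.
  - by rewrite tE.
rewrite /leA leq_eqVlt => /orP[/eqP iE|//].
have [atw _] := lw.1 q qw; by move: nE; rewrite (index_eq atw iE) eqxx.
Qed.

(** Position [q] takes the least new atom below the ceiling [g q]. One exists because the [q]
    letters already chosen have a join of rank [q], strictly below [g q]. *)
Lemma greedy_word (g : nat -> T) m :
  (forall p q, (p <= q < m)%N -> g p <= g q) ->
  (forall q, (q < m)%N -> (q < rank (g q))%N) ->
  exists w, [/\ size w = m, indep w & forall q, (q < m)%N ->
    nth \bot w q <= g q /\ forall b, atom b -> b <= g q ->
      ~~ (b <= joinw (take q w)) -> leA ao (nth \bot w q) b].
Proof.
elim: m => [|m IH] gle grk; first by exists [::].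
have [|q qm|w [sw iw wg]] := IH; first by move=> p q /andP[pq qm]; apply: gle; rewrite pq ltnW.
  exact/grk/ltnW.
have wgm : joinw w < g m.
  rewrite lt_neqAle; apply/andP; split; last first.
    rewrite joinw_le; apply/(all_nthP \bot) => i; rewrite sw => im.
    by apply: le_trans (wg i im).1 _; apply: gle; rewrite (ltnW im) /=.
  apply/eqP => wE; have := grk m (ltnSn m).
  by rewrite -wE -(take_size w) (indep_rank geomT iw) // sw ltnn.
have [a ata /andP[ag naw]] := atom_between geomT wgm.
pose P b := (b <= g m) && ~~ (b <= joinw w).
have hasP : has P ao by apply/hasP; exists a; rewrite ?ao_atom //; apply/andP.
(* [ao] lists the atoms in increasing order, so the first one satisfying [P] is the least. *)
pose c := nth \bot ao (find P ao); have := nth_find \bot hasP; rewrite -/c => Pc.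
have cao : c \in ao by rewrite mem_nth // -has_find.
exists (rcons w c); rewrite size_rcons sw; split=> // q; rewrite ?size_rcons ltnS leq_eqVlt.
  case/predU1P => [->|qm]; rewrite nth_rcons.
    rewrite ltnn eqxx -cats1 take_size_cat // -ao_atom cao; by case/andP: Pc.
  by rewrite qm -cats1 takel_cat ?(ltnW qm) //; apply: iw.
case/predU1P => [->|qm]; rewrite nth_rcons sw.
  rewrite ltnn eqxx -cats1 take_size_cat //; split; first by case/andP: Pc.
  move=> b; rewrite -ao_atom => bao bg nbw.
  rewrite /leA /c index_uniq -?has_find // leqNgt; apply/negP => /(before_find \bot).
  by rewrite nth_index // /P bg nbw.
by rewrite qm -cats1 takel_cat ?sw ?(ltnW qm) //; exact: wg.
Qed.
End Words.

(** * Rows and columns of the ribbon *)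

Section Ribbon.
Context (s : seq nat) (s_sorted : sorted ltn s) (s_gt0 : all (ltn 0) s).

Lemma s_uniq : uniq s.
Proof. by move: s_sorted; rewrite ltn_sorted_uniq_leq => /andP[]. Qed.

Lemma nth_rowof q i : (i < size s)%N -> (nth 0%N s i <= q)%N = (i < rowof s q)%N.
Proof.
move=> + ; rewrite /rowof; elim: s s_sorted i => [|x r IH] //= xr i.
have minx := allP (order_path_min ltn_trans xr).
have r0 : (q < x)%N -> count (fun y => y <= q)%N r = 0%N.
  move=> qx; apply/eqP; rewrite -leqn0 leqNgt -has_count.
  apply/hasPn => y /minx xy; rewrite -ltnNge; exact: ltn_trans xy.
case: i => [_|i] /=; first by have [//|qx] := leqP x q; rewrite (r0 qx).
rewrite ltnS => ir; have [xq|qx] := leqP x q; first by rewrite IH ?(path_sorted xr).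
by rewrite r0 // leqNgt (ltn_trans qx (minx _ (mem_nth 0%N ir))).
Qed.

Lemma rowofS q : rowof s q.+1 = (rowof s q + (q.+1 \in s))%N.
Proof.
rewrite /rowof -(count_uniq_mem _ s_uniq).
elim: s => //= x r ->; rewrite leq_eqVlt ltnS [RHS]addnACA; congr (_ + _)%N.
by case: eqVneq => [->|_]; rewrite ?ltnn ?addn0.
Qed.

Lemma rowof0 : rowof s 0 = 0%N.
Proof.
apply/eqP; rewrite -leqn0 leqNgt -has_count; apply/hasPn => x /(allP s_gt0).
by rewrite -ltnNge.
Qed.

(** Ensures that the subtraction defining [colof] never truncates. *)
Lemma rowof_leq q : (rowof s q <= q)%N.
Proof.
elim: q => [|q IH]; first by rewrite rowof0.
by rewrite rowofS -(addn1 q) leq_add // leq_b1.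
Qed.

(** The next box is above the current one at a rank of [s], and to its right otherwise. *)
Lemma colofS q : colof s q.+1 = (colof s q + (q.+1 \notin s))%N.
Proof.
have := rowof_leq q; rewrite /colof rowofS; case: (_ \in _) => /= h.
  by rewrite addn1 subSS addn0.
by rewrite addn0 subSn // addn1.
Qed.

Lemma rowof_homo p q : (p <= q)%N -> (rowof s p <= rowof s q)%N.
Proof. by move=> pq; apply: sub_count => x /leq_trans; apply. Qed.

Lemma colof_homo p q : (p <= q)%N -> (colof s p <= colof s q)%N.
Proof.
elim: q => [|q IH]; first by rewrite leqn0 => /eqP->.
rewrite leq_eqVlt ltnS => /predU1P[->//|/IH/leq_trans]; apply.
by rewrite colofS leq_addr.
Qed.

Lemma rowof_eq_notin p q e : rowof s p = rowof s q -> (p < e <= q)%N -> e \notin s.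
Proof.
case: e => // e E /andP[pe eq]; apply/negP => es.
have := leq_trans (rowof_homo pe) _; have := rowof_homo eq.
rewrite rowofS es addn1 -E ltnNge; have -> // := rowof_homo (pe : (p <= e)%N).
Qed.

Lemma rowof_notin_eq p q : (p <= q)%N ->
  (forall e, (p < e <= q)%N -> e \notin s) -> rowof s p = rowof s q.
Proof.
move=> pq De; apply: eq_in_count => x xs; apply/idP/idP => [/leq_trans|xq]; first exact.
by rewrite leqNgt; apply: contraL xs => px; apply: De; rewrite px.
Qed.

Lemma colof_eq_in p q e : colof s p = colof s q -> (p < e <= q)%N -> e \in s.
Proof.
case: e => // e E /andP[pe eq]; apply/negPn/negP => es.
have := colof_homo eq; rewrite colofS es addn1 -E ltnNge.
by have -> := colof_homo (pe : (p <= e)%N).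
Qed.

Lemma le_last_s e : e \in s -> (e <= last 0%N s)%N.
Proof.
move=> es; rewrite -nth_last -(nth_index 0%N es).
have ie : (index e s < size s)%N by rewrite index_mem.
rewrite leqNgt; apply/negP => lt.
have := sorted_ltn_nth ltn_trans 0%N s_sorted.
have sp : (0 < size s)%N by apply: leq_ltn_trans ie.
move/(_ (index e s) (size s).-1); rewrite !inE ie prednK // leqnn => H.
have : (index e s <= (size s).-1)%N by rewrite -ltnS prednK.
rewrite leq_eqVlt => /predU1P[E|/(H isT isT) lt2].
  by move: lt; rewrite E ltnn.
by have := ltn_trans lt lt2; rewrite ltnn.
Qed.

Lemma nth_s_lt i j : (i < j < size s)%N -> (nth 0%N s i < nth 0%N s j)%N.
Proof.
move=> /andP[ij js]; apply: (sorted_ltn_nth ltn_trans 0%N s_sorted) => //.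
by rewrite inE (ltn_trans ij).
Qed.
End Ribbon.

(** * Flags and their words; standard fillings and NBC+ bases in terms of labels *)

Section Flags.
Context {disp : Order.disp_t} {T : finTBLatticeType disp} (ao : seq T) (s : seq nat).
Context (geomT : geometric (T := T)) (ao_uniq : uniq ao).
Context (ao_atom : forall a : T, (a \in ao) = atom a).
Context (s_neq0 : s != [::]) (s_sorted : sorted ltn s) (s_gt0 : all (ltn 0) s).
Implicit Types (x y a b : T) (w v : seq T) (t : {ffun 'I_(size s) -> T}).
Local Open Scope order_scope.
Local Notation m := (last 0%N s).
Local Notation breaks := (fun e : nat => e \in s).

Lemma last_s_in : m \in s.
Proof. by case: s s_neq0 => // x r _; exact: mem_last. Qed.

Lemma rowof_lt_size q : (q < m)%N -> (rowof s q < size s)%N.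
Proof.
move=> qm; rewrite ltn_neqAle count_size andbT -all_count.
by apply/allPn; exists m; rewrite ?last_s_in // -ltnNge.
Qed.

Lemma chainflag_valid w : indep w -> size w = m -> valid_flag s (chainflag s w).
Proof.
move=> iw sw; have rk (i : 'I_(size s)) : rank (chainflag s w i) = nth 0%N s i.
  by rewrite ffunE (indep_rank geomT iw) // sw le_last_s ?mem_nth.
apply/andP; split; apply/forallP => i; first by rewrite rk.
apply/forallP => j; apply/implyP => ij.
have lt_ij : (nth 0%N s i < nth 0%N s j)%N by apply: nth_s_lt; rewrite ?ij /=.
rewrite lt_neqAle; apply/andP; split; last by rewrite !ffunE joinw_take_le // ltnW.
by apply/eqP => E; move: lt_ij; rewrite -!rk E ltnn.
Qed.

Lemma flag_word t : valid_flag s t -> exists w,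
  [/\ size w = m, labelseq ao w, ascends ao breaks w & chainflag s w = t].
Proof.
move=> /andP[/forallP trk /forallP tlt].
have tle (i j : 'I_(size s)) : (i <= j)%N -> t i <= t j.
  rewrite leq_eqVlt => /predU1P[/val_inj->//|ij].
  by have /forallP/(_ j)/implyP/(_ ij)/ltW := tlt i.
(* The ceiling of a position is the flag element of its row. The default [\bot] is never reached for
   [q < m]. *)
pose g q := oapp t \bot (insub (rowof s q)).
have gE q : (q < m)%N -> exists2 i : 'I_(size s), i = rowof s q :> nat & g q = t i.
  move=> qm; exists (Ordinal (rowof_lt_size qm)) => //.
  by rewrite /g (insubT (fun n => n < size s)%N (rowof_lt_size qm)).
have gle p q : (p <= q < m)%N -> g p <= g q.
  move=> /andP[pq qm]; have [i ip ->] := gE p (leq_ltn_trans pq qm).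
  by have [j jq ->] := gE q qm; apply: tle; rewrite ip jq rowof_homo.
have grk q : (q < m)%N -> (q < rank (g q))%N.
  move=> qm; have [i iq ->] := gE q qm; rewrite (eqP (trk i)) ltnNge nth_rowof //.
  by rewrite iq ltnn.
have [w [sw iw wg]] := greedy_word geomT ao_uniq ao_atom gle grk.
exists w; split=> //.
- split=> // q b; rewrite sw => qm atb bq; apply: (wg q qm).2 => //.
  apply: le_trans bq _; rewrite joinw_le; apply/(all_nthP \bot) => p.
  rewrite size_takel ?sw // => pq; rewrite nth_take //.
  have pm : (p < m)%N by apply: leq_trans qm.
  by apply: le_trans (wg p pm).1 _; apply: gle; rewrite qm andbT.
- move=> p q /andP[pq]; rewrite sw => qm De; have pm := leq_ltn_trans pq qm.
  have qw : (q < size w)%N by rewrite sw.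
  have [atq nq] := iw q qw.
  apply: (wg p pm).2 => //.
    by rewrite /g (rowof_notin_eq pq De); exact: (wg q qm).1.
  by apply: contra nq => /le_trans; apply; exact: joinw_take_le.
(* The letters before rank [nth 0 s i] sit in rows up to [i], so their join is below [t i]; equal
   ranks give equality. *)
apply/ffunP => i; rewrite ffunE.
have im : (nth 0%N s i <= m)%N by rewrite le_last_s ?mem_nth.
apply: rank_eq; last by rewrite (eqP (trk i)) (indep_rank geomT iw) ?sw.
rewrite joinw_le; apply/(all_nthP \bot) => p.
rewrite size_takel ?sw // => pi; rewrite nth_take //.
have pm := leq_trans pi im; apply: le_trans (wg p pm).1 _.
have [j jp ->] := gE p pm; apply: tle.
by rewrite jp leqNgt -nth_rowof // -ltnNge.
Qed.

Lemma standard_ascends w : standard s ao w -> ascends ao breaks w.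
Proof.
move=> /andP[/forallP rows _] p q /andP[pq qw] De.
have [->|npq] := eqVneq p q; first exact: leqnn.
have pw := leq_ltn_trans pq qw.
have /forallP/(_ (Ordinal qw)) := rows (Ordinal pw).
rewrite /= (rowof_notin_eq pq De) eqxx ltn_neqAle npq pq; exact: ltnW.
Qed.

(** Rows are strict because letters are distinct. All positions between two boxes of one column are
    breaks, so descents at successive breaks compose along the column. *)
Lemma ascends_standard w : indep w -> ascends ao breaks w ->
  (forall e, e \in s -> (e < size w)%N -> ltA ao (nth \bot w e) (nth \bot w e.-1)) ->
  standard s ao w.
Proof.
move=> iw asc desc; apply/andP; split.
  apply/forallP => p; apply/forallP => q; apply/implyP => /andP[/eqP row pq].
  rewrite /ltA ltn_neqAle; apply/andP; split; last first.
    apply: asc => [|e /(rowof_eq_notin s_sorted row)//].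
    by rewrite ltn_ord (ltnW pq).
  apply/eqP => E; have [atp _] := iw p (ltn_ord p).
  have /eqP := index_eq ao_atom atp E.
  by rewrite nth_uniq ?(indep_uniq iw) // ltn_eqF.
apply/forallP => p; apply/forallP => q; apply/implyP => /andP[/eqP col rpq].
have pq : (p < q)%N by rewrite ltnNge; apply: contraL rpq => /(rowof_homo s); rewrite leqNgt.
have br := colof_eq_in s_sorted s_gt0 col.
move: (ltn_ord q) pq br; move: (q : nat) => {col rpq q}; elim=> // q IH qw.
rewrite ltnS leq_eqVlt => /predU1P[pq|pq] br.
  by rewrite pq; apply: (desc q.+1) => //; apply: br; rewrite pq ltnSn /=.
apply: ltn_trans (IH (ltnW qw) pq _); first by apply: (desc q.+1) => //; rewrite br // leqnn ltnW.
by move=> e /andP[pe eq]; apply: br; rewrite pe leqW.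
Qed.

(** The NBC condition follows from minimality of labels: an atom below the join enters at some step,
    whose label precedes it unless it is the atom itself. *)
Lemma nbc_plusP (u : T) w : nbc_plus_basis ao u w <-> labelseq ao w /\ u = joinw w.
Proof.
split.
  move=> /and4P[wu /and4P[_ atw /eqP rw _] /eqP su /forallP minw].
  have iw := rank_indep geomT atw rw; split.
    split=> // q b qw atb bq nbq.
    have /and4P[_ _ _ /forallP/(_ b)] := minw (Ordinal qw).
    by rewrite /= atb bq nbq.
  by symmetry; apply: rank_eq; rewrite ?joinw_le // rw su.
move=> [[iw minw] ->]; have rw : rank (joinw w) = size w.
  by rewrite -{1}(take_size w) (indep_rank geomT iw).
apply/and4P; split; last 1 first.
- apply/forallP => j; have [atj nj] := iw j (ltn_ord j).
  rewrite /= atj nj le_joinw_nth //=; apply/forallP => b; apply/implyP.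
  by move=> /andP[/andP[atb bj] nbj]; apply: minw.
- by rewrite -joinw_le.
- apply/and4P; split; rewrite ?indep_uniq ?indep_atom ?rw //.
  apply/forallP => b; apply/implyP => /andP[/andP[atb bw] nbw].
  have nb0 : ~~ (b <= joinw (take 0 w)).
    by rewrite take0 /joinw big_nil lex0; have /andP[] := atb; rewrite lt0x.
  rewrite -{1}(take_size w) in bw.
  have [i /andP[_ iw'] /andP[bi bi1]] := joinw_step (leq0n _) nb0 bw.
  apply/hasP; exists (nth \bot w i); first exact: mem_nth.
  rewrite /ltA ltn_neqAle; apply/andP; split; last exact: (minw i b iw' atb bi1 bi).
  apply/eqP => /(index_eq ao_atom (iw i iw').1) E.
  by move: nbw; rewrite -E mem_nth.
- by rewrite rw.
Qed.
End Flags.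

(** * Linear algebra of triangular families *)

Section Triangular.
Context (K : fieldType) (A : finType) (I : eqType) (r : seq I).
Context (v : I -> {ffun A -> K^o}) (l : I -> A) (c : I -> nat).
Local Open Scope ring_scope.
Context (r_uniq : uniq r) (v_diag : {in r, forall p, v p (l p) = 1}).
Context (v_tri : {in r &, forall p q, v p (l q) != 0 -> q = p \/ (c q < c p)%N}).

(** In a vanishing combination, evaluate at the leading point of a term with nonzero coefficient and
    maximal [c]: any other contributing term would have larger [c]. *)
Lemma triangular_free : free (map v r).
Proof.
have -> : map v r = in_tuple (map v r) by [].
apply/freeP => k sum0; case: (pickP (fun i => k i != 0)) => [i0 ki0|k0 i]; last first.
  exact/eqP/negbFE/k0.
exfalso.
have szr (i : 'I_(size (map v r))) : (i < size r)%N by rewrite -(size_map v).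
(* [I] has no distinguished element, so the entry at [i0] serves as default for [nth]. *)
pose pt (i : 'I_(size (map v r))) : I := nth (tnth (in_tuple r) (Ordinal (szr i0))) r i.
have ptr i : pt i \in r by rewrite mem_nth.
have vE (i : 'I_(size (map v r))) : (map v r)`_i = v (pt i).
  by rewrite (nth_map (pt i0)) //; congr (v _); apply: set_nth_default.
case: (@arg_maxnP _ i0 (fun i => k i != 0) (fun i => c (pt i)) ki0) => i ki maxi.
have := congr1 (fun f : {ffun _ -> _} => f (l (pt i))) sum0.
rewrite sum_ffunE ffunE (bigD1 i) //= big1 => [|j ji].
  rewrite addr0 ffunE vE v_diag // => E; move/eqP: ki; apply.
  by rewrite -[LHS]mulr1; exact: E.
rewrite ffunE vE; have [->|kj] := eqVneq (k j) 0; first by rewrite scale0r.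
have [->|/(v_tri (ptr j) (ptr i))] := eqVneq (v (pt j) (l (pt i))) 0.
  by rewrite scaler0.
case=> [E|]; last by rewrite ltnNge => /negP[]; apply: maxi.
by move/eqP: E; rewrite /pt nth_uniq // eq_sym; move: ji => /negPf; rewrite -val_eqE /= => ->.
Qed.

Context (C : {ffun A -> K^o} -> Prop).
Context (C_lin : forall a f g, C f -> C g -> C (a *: f + g)) (vC : {in r, forall p, C (v p)}).
Context (C_det : forall f, C f -> {in r, forall p, f (l p) = 0} -> f = 0).

(** Leading values are cleared from the highest level of [c] downwards. Subtracting [h] kills those
    at level [n] and leaves the higher ones zero, since [v p] vanishes at leading points of higher
    level. At level zero [C_det] applies. *)
Lemma triangular_span f : C f -> f \in <<map v r>>%VS.
Proof.
suff H n : forall f, C f -> (forall p, p \in r -> (n <= c p)%N -> f (l p) = 0) ->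
    f \in <<map v r>>%VS.
  move=> Cf; apply: (H (\max_(p <- r) c p).+1) => // p pr.
  by rewrite ltnNge leq_bigmax_seq.
elim: n => [|n IH] {}f Cf f0.
  by rewrite (C_det Cf) ?mem0v // => p pr; apply: f0.
pose h := \sum_(p <- r | c p == n) f (l p) *: v p.
have hX : h \in <<map v r>>%VS.
  rewrite /h big_seq_cond; apply: memv_suml => p /andP[pr _].
  by apply/memvZ/memv_span/map_f.
rewrite -[f](subrK h) memvD // IH {hX}//.
  rewrite /h -sumrN big_seq_cond; elim/big_rec: _ => [|p g /andP[pr _] Cg].
    by rewrite addr0.
  by rewrite addrCA -scaleNr; apply: C_lin => //; apply: vC.
move=> q qr nq; rewrite !ffunE /h sum_ffunE.
have vq p : p \in r -> p != q -> (c p <= c q)%N -> v p (l q) = 0.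
  move=> pr pq cpq; apply/eqP; apply: contraT => /(v_tri pr qr)[E|].
    by rewrite E eqxx in pq.
  by rewrite ltnNge cpq.
have [cq|cq] := eqVneq (c q) n; last first.
  rewrite f0 // ?ltn_neqAle 1?eq_sym ?cq // big_seq_cond big1 ?subr0 // => p /andP[pr /eqP cp].
  rewrite ffunE vq ?scaler0 // ?cp //.
  by apply: contra_neq cq => <-.
rewrite big_mkcond (bigD1_seq q) //= cq eqxx ffunE v_diag //.
rewrite (_ : _ *: _ = f (l q)); last exact: mulr1.
rewrite big_seq_cond big1 ?addr0 ?subrr // => p /andP[pr pq].
by case: eqP => // cp; rewrite ffunE vq ?scaler0 // cp cq.
Qed.
End Triangular.

(** * Column permutations: cycles and leading terms *)

Section RibbonCycles.
Context (R : realType) {disp : Order.disp_t} {T : finTBLatticeType disp}.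
Context (ao : seq T) (s : seq nat).
Context (geomT : geometric (T := T)) (s_sorted : sorted ltn s) (s_gt0 : all (ltn 0) s).
Local Notation m := (last 0%N s).
Implicit Types (w : m.-tuple T) (sigma : 'S_m) (t : {ffun 'I_(size s) -> T}).
Local Open Scope ring_scope.

Definition permword w sigma : m.-tuple T := [tuple tnth w (sigma i) | i < m].

Definition colperm sigma := [forall i, colof s (sigma i) == colof s i].

Lemma vF_coef w t : vF R s w t =
  \sum_(sigma | colperm sigma) (-1) ^+ sigma * (t == chainflag s (permword w sigma))%:R.
Proof. by rewrite sum_ffunE; apply: eq_bigr => sigma _; rewrite !ffunE. Qed.

Lemma nth_permword w sigma (i : 'I_m) : nth \bot%O (permword w sigma) i = tnth w (sigma i).
Proof. by rewrite -tnth_nth tnth_mktuple. Qed.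

Lemma permword1 w : permword w 1%g = w.
Proof. by apply: eq_from_tnth => i; rewrite tnth_mktuple perm1. Qed.

Lemma perm_permword w sigma : perm_eq (permword w sigma) w.
Proof. by apply/tuple_permP; exists sigma. Qed.

Lemma permword_indep w sigma : indep w -> indep (permword w sigma).
Proof. by apply: perm_indep => //; exact: perm_permword. Qed.

Lemma permword_inj w sigma : uniq w -> w = permword w sigma -> sigma = 1%g.
Proof.
move=> uw wE; apply/permP => i; rewrite perm1; apply/val_inj/eqP.
rewrite -(nth_uniq \bot%O _ _ uw) ?size_tuple ?ltn_ord //.
by rewrite -tnth_nth -nth_permword -wE.
Qed.

Lemma joinw_take_tuple w e :
  joinw (take e w) = (\join_(k < m | (k < e)%N) tnth w k)%O.
Proof.
apply/le_anti/andP; split.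
  rewrite joinw_le; apply/(all_nthP \bot%O) => p.
  rewrite size_take_min size_tuple leq_min => /andP[pe pm]; rewrite nth_take //.
  rewrite -[p]/(nat_of_ord (Ordinal pm)) -tnth_nth.
  exact: (joins_sup (j := Ordinal pm)).
by apply/joinsP => k ke; rewrite (tnth_nth \bot%O) le_joinw_nth ?size_tuple.
Qed.

(** Only the prefix of length [b] separates the two adjacent positions; every other prefix keeps its
    set of letters. *)
Lemma joinw_take_tperm w sigma (a b : 'I_m) e : b = a.+1 :> nat -> e != b :> nat ->
  joinw (take e (permword w (tperm a b * sigma))) = joinw (take e (permword w sigma)).
Proof.
move=> bE eb; rewrite !joinw_take_tuple [RHS](reindex_inj (@perm_inj _ (tperm a b))) /=.
apply: eq_big => [k|k _]; last by rewrite !tnth_mktuple permM.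
case: tpermP => [->|->|//]; rewrite bE; move: eb; rewrite bE => eb.
  by rewrite [in RHS]ltn_neqAle eq_sym eb.
by rewrite [in LHS]ltn_neqAle eq_sym eb.
Qed.

(** The simplex [h] contributes to the face of [t] omitting [j] exactly when the two agree away from
    [j], and then only through [y = h j]. *)
Lemma sum_upd (h t : {ffun 'I_(size s) -> T}) (j : 'I_(size s)) : valid_flag s h ->
  \sum_(y | valid_flag s (upd s t j y)) (upd s t j y == h)%:R
  = [forall i, (i != j) ==> (t i == h i)]%:R :> R[i].
Proof.
move=> vh; have [/forallP agree|/forallPn/= [i ni]] := boolP [forall i, (i != j) ==> (t i == h i)].
  have E : upd s t j (h j) = h.
    apply/ffunP => i; rewrite ffunE; case: eqP => [->//|/eqP ij].
    exact/eqP/(implyP (agree i)).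
  rewrite (bigD1 (h j)) /= ?E ?eqxx // big1 ?addr0 // => y /andP[_ yj].
  case: eqP => // /ffunP/(_ j); rewrite ffunE eqxx => yE.
  by rewrite yE eqxx in yj.
rewrite big1 // => y _; case: eqP => // /ffunP/(_ i).
by move: ni; rewrite ffunE negb_imply => /andP[/negPf-> /eqP].
Qed.

(** A sign-reversing involution: composing with a transposition inside a column preserves the face
    omitting [j] and flips the sign, so each boundary coefficient equals its own opposite. *)
Lemma vF_cycle w : indep w -> is_cycle R s (vF R s w).
Proof.
move=> iw; have vld sigma : valid_flag s (chainflag s (permword w sigma)).
  by apply: chainflag_valid; rewrite ?size_tuple //; apply: permword_indep.
apply/andP; split.
  apply/forallP => t; apply/implyP => nt; rewrite vF_coef big1 // => sigma _.
  by case: eqP => [E|_]; [rewrite E vld in nt|rewrite mulr0].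
apply/forallP => t; apply/forallP => j; apply/implyP => /andP[_ js].
pose c sigma : R[i] :=
  [forall i, (i != j) ==> (t i == chainflag s (permword w sigma) i)]%:R.
have -> : \sum_(y | valid_flag s (upd s t j y)) vF R s w (upd s t j y) =
    \sum_(sigma | colperm sigma) (-1) ^+ sigma * c sigma.
  under eq_bigr do rewrite vF_coef.
  rewrite exchange_big; apply: eq_bigr => sigma _.
  by rewrite -mulr_sumr (sum_upd _ _ (vld sigma)).
have sj_lt : (nth 0%N s j < m)%N.
  have H n k : (k.+1 < n)%N -> (k < n.-1 < n)%N by case: n => // n; rewrite ltnS => ->/=.
  by rewrite -nth_last; apply: nth_s_lt => //; apply: H.
have sj_gt0 : (0 < nth 0%N s j)%N by apply: (allP s_gt0); rewrite mem_nth.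
(* [a] is the last box of row [j] and [b] the first box of the next row, directly above it. *)
pose b := Ordinal sj_lt; pose a := Ordinal (leq_ltn_trans (leq_pred _) sj_lt).
have bE : b = a.+1 :> nat by rewrite /= prednK.
have colab : colof s a = colof s b.
  by rewrite [RHS]/= -(prednK sj_gt0) colofS // prednK // mem_nth // addn0.
pose tau := tperm a b.
have colP sigma : colperm (tau * sigma) = colperm sigma.
  have sub sg : colperm sg -> colperm (tau * sg).
    move=> /forallP cs; apply/forallP => i; rewrite permM (eqP (cs _)).
    by rewrite /tau; case: tpermP => [->|->|] //; rewrite colab.
  apply/idP/idP => /sub //; by rewrite mulgA tperm2 mul1g.
have cE sigma : c (tau * sigma)%g = c sigma.
  congr (_ %:R); congr nat_of_bool; apply: eq_forallb => i.
  case: eqVneq => //= ij; congr (_ == _); rewrite !ffunE.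
  apply: joinw_take_tperm => //=; rewrite nth_uniq ?s_uniq //.
set S := \sum_(sigma | _) _; apply/eqP; apply/eqP.
have : S = - S.
  rewrite {1}/S (reindex_inj (mulgI tau)) /= -sumrN; apply: eq_big => // sigma _.
  rewrite cE odd_permM odd_tperm.
  have -> : a != b by apply/eqP => ab; move: bE; rewrite -ab => /n_Sn.
  by rewrite signrN mulNr.
by move/eqP; rewrite eq_sym eqNr.
Qed.

(** At the first changed position [q], all earlier positions are fixed, so [sigma] brings in a later
    box of the same column. That box is higher and holds a smaller entry. *)
Lemma standard_col w sigma : uniq w -> standard s ao w -> colperm sigma ->
  sigma = 1%g \/ (code ao (permword w sigma) < code ao w)%N.
Proof.
move=> uw /andP[_ /forallP cols] /forallP colsg.
have szE : size (permword w sigma) = size w by rewrite !size_tuple.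
have [E|[q [qw tE nE]]] := first_diff szE.
  by left; apply: (permword_inj uw); apply: val_inj; rewrite /= E.
right; apply: (code_lt szE qw tE).
have qm : (q < m)%N by move: qw; rewrite size_tuple.
have fixed (p : 'I_m) : (p < q)%N -> sigma p = p.
  move=> pq; apply/val_inj/eqP; rewrite -(nth_uniq \bot%O _ _ uw) ?size_tuple ?ltn_ord //.
  have := congr1 (nth \bot%O ^~ p) tE; rewrite !nth_take // nth_permword.
  by rewrite (tnth_nth \bot%O) => ->.
have nth_q : nth \bot%O (permword w sigma) q = tnth w (sigma (Ordinal qm)).
  exact: nth_permword (Ordinal qm).
have sq_gt : (q < sigma (Ordinal qm))%N.
  rewrite ltn_neqAle; apply/andP; split.
    by apply: contra_neq nE => E; rewrite nth_q (tnth_nth \bot%O) -E.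
  rewrite leqNgt; apply/negP => lt; have := fixed _ lt.
  by move/perm_inj => E; move: lt; rewrite E ltnn.
have qw0 : (q < size w)%N by rewrite -szE.
have sw : (sigma (Ordinal qm) < size w)%N by rewrite size_tuple.
rewrite nth_q (tnth_nth \bot%O).
have /forallP/(_ (Ordinal sw))/implyP := cols (Ordinal qw0); apply.
rewrite eq_sym (eqP (colsg _)) eqxx /=.
(* Position is row plus column, so a later position in the same column lies in a higher row. *)
have /eqP := colsg (Ordinal qm); rewrite /colof /= => colE.
have rle := rowof_leq s_sorted s_gt0.
by rewrite -(ltn_add2r (q - rowof s q)) subnKC // -colE subnKC.
Qed.
End RibbonCycles.

(** * Triangularity of the ribbon cycles and determination of cycles by leading coefficients *)

Section Basis.
Context (R : realType) {disp : Order.disp_t} {T : finTBLatticeType disp}.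
Context (ao : seq T) (s : seq nat).
Context (geomT : geometric (T := T)) (ao_uniq : uniq ao).
Context (ao_atom : forall a : T, (a \in ao) = atom a).
Context (s_neq0 : s != [::]) (s_sorted : sorted ltn s) (s_gt0 : all (ltn 0) s).
Local Notation m := (last 0%N s).
Local Notation breaks := (fun e : nat => e \in s).
Implicit Types (w v : m.-tuple T) (t : {ffun 'I_(size s) -> T}).
Local Open Scope ring_scope.

Lemma chainflag_join (w : seq T) e (es : (index e s < size s)%N) :
  e \in s -> chainflag s w (Ordinal es) = joinw (take e w).
Proof. by move=> ein; rewrite ffunE /= nth_index. Qed.

Lemma chainflag_code_min (w v : seq T) : labelseq ao w -> ascends ao breaks w ->
  indep v -> size w = m -> size v = m -> chainflag s w = chainflag s v ->
  w = v \/ (code ao w < code ao v)%N.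
Proof.
move=> lw aw iv sw sv wv.
apply: (labelseq_code_min ao_atom lw aw iv); rewrite ?sw ?sv ?last_s_in // => e _ es.
by move: (es); rewrite -index_mem => ie; rewrite -!(chainflag_join _ ie) ?wv.
Qed.

(** A flag in the support of [vF R s v] comes from a column permutation of [v]. The code of [w] is
    at most that of the permuted word, which is at most that of [v]. *)
Lemma vF_support w v : labelseq ao w -> ascends ao breaks w ->
  labelseq ao v -> standard s ao v ->
  vF R s v (chainflag s w) != 0 -> w = v \/ (code ao w < code ao v)%N.
Proof.
move=> lw aw lv sv; rewrite vF_coef => nz.
have [/existsP[sigma /andP[cs /eqP E]]|/existsPn nex] := boolP [exists sigma,
    colperm sigma && (chainflag s w == chainflag s (permword v sigma))]; last first.
  move: nz; rewrite big1 ?eqxx // => sigma cs.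
  by have := nex sigma; rewrite cs /= => /negPf->; rewrite mulr0.
have iv : indep (permword v sigma) by apply: permword_indep => //; exact: lv.1.
have vsig := standard_col s_sorted s_gt0 (indep_uniq lv.1) sv cs.
have [wE|lt] := chainflag_code_min lw aw iv (size_tuple w) (size_tuple _) E; last first.
  right; case: vsig => [s1|]; last exact: ltn_trans.
  by move: lt; rewrite s1 permword1.
case: vsig => [s1|]; last by rewrite -wE; right.
by left; apply: val_inj; rewrite /= wE s1 permword1.
Qed.

(** A nontrivial column permutation with the same flag would have a smaller code than [w], against
    minimality of [w] for its flag. *)
Lemma vF_diag w : labelseq ao w -> standard s ao w -> vF R s w (chainflag s w) = 1.
Proof.
move=> lw sw; have aw := standard_ascends sw; have uw := indep_uniq lw.1.
have col1 : colperm (1%g : 'S_m) by apply/forallP => i; rewrite perm1.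
rewrite vF_coef (bigD1 1%g) // permword1 eqxx odd_perm1 expr0 mulr1.
rewrite big1; first exact: addr0.
move=> sigma /andP[cs s1]; case: eqP => [E|]; last by rewrite mulr0.
have [/eqP|lts] := standard_col s_sorted s_gt0 uw sw cs; first by rewrite (negPf s1).
have iv : indep (permword w sigma) by apply: permword_indep => //; exact: lw.1.
have [wE|lt] := chainflag_code_min lw aw iv (size_tuple w) (size_tuple _) E.
  by move: lts; rewrite -wE ltnn.
by have := ltn_trans lt lts; rewrite ltnn.
Qed.

Lemma ascends_merge (w : seq T) e : ascends ao breaks w -> (0 < e < size w)%N ->
  leA ao (nth \bot%O w e.-1) (nth \bot%O w e) ->
  ascends ao (fun i => (i \in s) && (i != e)) w.
Proof.
move=> aw /andP[e0 ew] wee p q /andP[pq qw] De.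
have [/andP[pe eq]|npq] := boolP (p < e <= q)%N; last first.
  apply: aw => [|i piq]; first by rewrite pq.
  have := De i piq; rewrite negb_and negbK => /orP[//|/eqP ie].
  by rewrite -ie piq in npq.
have h i : (p < i <= q)%N -> i != e -> i \notin s.
  by move=> piq ie; have := De i piq; rewrite ie andbT.
apply: leq_trans (_ : (_ <= index (nth \bot%O w e.-1) ao)%N) _.
  apply: aw => [|i /andP[pi ie]]; first by rewrite -ltnS prednK // pe ltnW.
  have ie' : (i < e)%N by rewrite -(prednK e0).
  by apply: h; rewrite ?pi ?(ltn_eqF ie') //= (leq_trans (ltnW ie')).
apply: leq_trans wee _; apply: aw => [|i /andP[ei iq]]; first by rewrite eq.
by apply: h; rewrite ?iq ?(ltn_trans pe) // gtn_eqF.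
Qed.

(* If [w] ascends at a break [e], deleting the element of rank [e] from its
   flag leaves [w] minimal, so all other flags in the corresponding boundary
   relation have strictly larger words. *)
Lemma cycle_determined (f : flagspace R s) : is_cycle R s f ->
  (forall w, labelseq ao w -> standard s ao w -> f (chainflag s w) = 0) -> f = 0.
Proof.
move=> /andP[/forallP supp /forallP bd] f0.
suff H (w : seq T) : size w = m -> labelseq ao w -> ascends ao breaks w ->
    f (chainflag s w) = 0.
  apply/ffunP => t; rewrite [RHS]ffunE.
  have [vt|/(implyP (supp t))/eqP//] := boolP (valid_flag s t).
  by have [w [sw lw aw <-]] := flag_word geomT ao_uniq ao_atom s_neq0 s_sorted vt; apply: H.
(* [B] exceeds the code of every word of length [m], so induction on [B - code ao w] treats larger
   words first. *)
pose B := ((size ao).+1 ^ m)%N.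
have [n] := ubnP (B - code ao w)%N; elim: n => // n IH in w *.
rewrite ltnS => wn sw lw aw.
have [desc|/allPn[e es]] := boolP (all (fun e => (e < size w)%N ==>
    ltA ao (nth \bot%O w e) (nth \bot%O w e.-1)) s).
  have stw : standard s ao w.
    by apply: (ascends_standard ao_atom s_sorted s_gt0 lw.1 aw) => e es; apply/implyP/(allP desc).
  have sw' : size w == m by apply/eqP.
  exact: (f0 (Tuple sw')).
rewrite negb_imply -leqNgt => /andP[ew wee].
have e0 : (0 < e)%N := allP s_gt0 _ es.
have ie : (index e s < size s)%N by rewrite index_mem.
pose j := Ordinal ie; set t := chainflag s w.
have vt : valid_flag s t by apply: chainflag_valid => //; exact: lw.1.
(* A break inside the word is not the top rank, so [j] is a vertex of the simplex and has a boundary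
   relation. *)
have js : (j.+1 < size s)%N.
  rewrite ltn_neqAle ie andbT; apply: contraTneq ew => E.
  by rewrite -leqNgt sw -nth_last -E /= nth_index.
have /forallP/(_ j)/implyP := bd t; rewrite vt js => /(_ isT)/eqP.
have tj : upd s t j (t j) = t by apply/ffunP => i; rewrite ffunE; case: eqP => // ->.
rewrite (bigD1 (t j)) /= tj // big1 ?addr0 // => y /andP[vy yt].
have [v [sv lv av vE]] := flag_word geomT ao_uniq ao_atom s_neq0 s_sorted vy.
rewrite -vE; apply: IH => //.
have wv : w = v \/ (code ao w < code ao v)%N.
  have ew' : (0 < e < size w)%N by rewrite e0.
  apply: (labelseq_code_min ao_atom lw (ascends_merge aw ew' wee) lv.1); rewrite ?sv ?sw //.
    by rewrite last_s_in //= -sw gtn_eqF.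
  move=> i _ /andP[iS ine]; move: (iS); rewrite -index_mem => ii.
  rewrite -!(chainflag_join _ ii) // vE [RHS]ffunE; case: eqP => [/(congr1 (@nat_of_ord _))/= E|//].
  by rewrite -(nth_index 0%N iS) E nth_index ?eqxx in ine.
have lt_wv : (code ao w < code ao v)%N.
  case: wv => // E; move: yt; rewrite /t E vE.
  by rewrite ffunE eqxx eqxx.
apply: leq_trans wn; apply: ltn_sub2l => //.
by rewrite /B -sv; apply: ltn_trans lt_wv (code_bound ao v).
Qed.

End Basis.

Unset Implicit Arguments.

Theorem theorem5p30 (R : realType) (disp : Order.disp_t)
  (T : finTBLatticeType disp) (ao : seq T) (s : seq nat) :
  geometric (T := T) ->
  uniq ao -> (forall a : T, (a \in ao) = atom a) ->
  s != [::] -> sorted ltn s ->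
  all (fun x => (0 < x <= rank (\top%O : T))%N) s ->
  let X := WH_family R s ao in
  [/\ forall x, x \in X -> is_cycle R s x,
      free X &
      forall f : flagspace R s, is_cycle R s f -> f \in <<X>>%VS].
Proof.
move=> geomT ao_uniq ao_atom s_neq0 s_sorted s_rk X.
have s_gt0 : all (ltn 0) s by apply: sub_all s_rk => x /andP[].
rewrite /X /WH_family; set r := enum _.
have rP p : p \in r -> [/\ labelseq ao p.2, standard s ao p.2 & p.1 = joinw p.2].
  by rewrite mem_enum => /and3P[_ st /(nbc_plusP geomT ao_atom)[]].
have r_uniq : uniq r := enum_uniq _.
pose v (p : T * (last 0%N s).-tuple T) := vF R s p.2.
pose l (p : T * (last 0%N s).-tuple T) := chainflag s p.2.
pose c (p : T * (last 0%N s).-tuple T) := code ao p.2.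
have v_diag : {in r, forall p, v p (l p) = 1%R} by move=> p /rP[? ? _]; apply: vF_diag.
have v_tri : {in r &, forall p q, v p (l q) != 0%R -> q = p \/ (c q < c p)%N}.
  move=> p q /rP[lp sp p1] /rP[lq sq q1] /(vF_support geomT ao_atom s_neq0 s_sorted s_gt0 lq).
  case=> // [|E|]; [exact: standard_ascends| |by right].
  (* The element [u] of a pair is the join of its word, so equal words give equal pairs. *)
  by left; apply/eqP; rewrite -pair_eqE /pair_eq p1 q1 E !eqxx.
have cyc p : p \in r -> is_cycle R s (v p).
  by move=> /rP[[ip _] _ _]; apply: vF_cycle.
split.
- by move=> x /mapP[p /cyc ? ->].
- exact: triangular_free r_uniq v_diag v_tri.
apply: (triangular_span r_uniq v_diag v_tri) => //.
  move=> a f g /andP[/forallP f1 /forallP f2] /andP[/forallP g1 /forallP g2].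
  apply/andP; split; apply/forallP => t; first apply/implyP => nt.
    by rewrite !ffunE (eqP (implyP (f1 t) nt)) (eqP (implyP (g1 t) nt)) scaler0 addr0.
  apply/forallP => j; apply/implyP => tj.
  under eq_bigr do rewrite !ffunE.
  rewrite big_split /= -scaler_sumr.
  have /forallP/(_ j)/implyP/(_ tj)/eqP -> := f2 t.
  have /forallP/(_ j)/implyP/(_ tj)/eqP -> := g2 t.
  by rewrite scaler0 addr0.
move=> f cf f0; apply: (cycle_determined geomT ao_uniq ao_atom s_neq0 s_sorted s_gt0 cf).
move=> w lw sw; apply: (f0 (joinw w, w)); rewrite mem_enum; apply/and3P; split => //=.
  by rewrite -(take_size w) (indep_rank geomT lw.1) ?size_tuple.
exact/(nbc_plusP geomT ao_atom).
Qed.
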